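(* Let $X$ and $Y$ be Banach spaces. If $X$ and $Y$ are almost square (ASQ), then the projective tensor product $X\widehat{\otimes}_\pi Y$ is almost square.
   Context: All Banach spaces are real; $B_X$ and $S_X$ denote the closed unit ball and the unit sphere of $X$. A Banach space $X$ is almost square (ASQ) if for every $k\in\mathbb N$ and every $x_1,\ldots,x_k\in S_X$ there exists a sequence $\{y_n\}$ in $B_X$ such that $\Vert y_n\Vert\to 1$ and $\Vert x_i\pm y_n\Vert\to 1$ for every $i\in\{1,\ldots,k\}$. The projective tensor product $X\widehat{\otimes}_\pi Y$ is the completion of the algebraic tensor product $X\otimes Y$ under the norm $\Vert u\Vert:=\inf\{\sum_{i=1}^n\Vert x_i\Vert\Vert y_i\Vert : u=\sum_{i=1}^n x_i\otimes y_i\}$. *)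

(* Defs.v *)
From HB Require Import structures.
From mathcomp Require Import all_boot all_order all_algebra.
From mathcomp Require Import all_classical all_reals all_analysis.
From mathcomp Require Import lra.

Set Implicit Arguments.
Unset Strict Implicit.
Unset Printing Implicit Defensive.

Import Order.TTheory GRing.Theory Num.Theory.
Import numFieldNormedType.Exports.

Local Open Scope classical_set_scope.
Local Open Scope ring_scope.

(* The convention is k >= 1, so that the zero space is (vacuously) almost
   square. *)
Definition almost_square (R : realType) (X : normedModType R) : Prop :=
  forall (k : nat) (x : 'I_k -> X), (0 < k)%N ->
    (forall i, `|x i| = 1) ->
    exists y : nat -> X,
      [/\ forall n, `|y n| <= 1,
          `|y n| @[n --> \oo] --> (1 : R) &
          forall i, `|x i + y n| @[n --> \oo] --> (1 : R) /\
                    `|x i - y n| @[n --> \oo] --> (1 : R)].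

(* The algebraic tensor product, following Ryan (Introduction to Tensor
   Products of Banach Spaces, 1.1): x (x) y is the evaluation functional
   B |-> B x y on the space of all (not necessarily bounded) bilinear forms,
   and X (x) Y is the span of these functionals.  As
   a *: (x (x) y) = (a *: x) (x) y, the span consists of the finite sums of
   elementary tensors. *)
Section AlgebraicTensorProduct.
Variables (R : realType) (X Y : lmodType R).

Definition elementary_tensor (x : X) (y : Y) :
  {bilinear X -> Y -> R^o} -> R^o := fun B => B x y.

Definition tensor_sum (s : seq (X * Y)) : {bilinear X -> Y -> R^o} -> R^o :=
  \sum_(p <- s) elementary_tensor p.1 p.2.

Definition is_tensor : {pred {bilinear X -> Y -> R^o} -> R^o} :=
  fun u => `[< exists s, u = tensor_sum s >].

Lemma tensor_sum_cat s t :
  tensor_sum (s ++ t) = tensor_sum s + tensor_sum t.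
Proof. by rewrite /tensor_sum big_cat. Qed.

Lemma tensor_sumZ a s :
  a *: tensor_sum s = tensor_sum [seq (a *: p.1, p.2) | p <- s].
Proof.
rewrite /tensor_sum big_map scaler_sumr; apply: eq_bigr => p _.
by apply/funext => B; rewrite /elementary_tensor /= linearZl_LR.
Qed.

Lemma is_tensor_submod_closed : submod_closed is_tensor.
Proof.
split=> [|a u v /asboolP[s ->] /asboolP[t ->]]; apply/asboolP.
  by exists [::]; rewrite /tensor_sum big_nil.
by eexists; rewrite tensor_sumZ -tensor_sum_cat.
Qed.

HB.instance Definition _ :=
  GRing.isSubmodClosed.Build R ({bilinear X -> Y -> R^o} -> R^o) is_tensor
    is_tensor_submod_closed.

Record alg_tensor := AlgTensor {
  tensor_functional :> {bilinear X -> Y -> R^o} -> R^o;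
  _ : tensor_functional \in is_tensor }.

HB.instance Definition _ := [isSub for tensor_functional].
HB.instance Definition _ := [Choice of alg_tensor by <:].
HB.instance Definition _ := [SubChoice_isSubLmodule of alg_tensor by <:].

End AlgebraicTensorProduct.

Record seminorm (R : realType) (V : lmodType R) := Seminorm {
  seminorm_fun :> V -> R;
  seminormD : forall u v,
    seminorm_fun (u + v) <= seminorm_fun u + seminorm_fun v;
  seminormZ : forall a u, seminorm_fun (a *: u) = `|a| * seminorm_fun u }.

Section ProjectiveNorm.
Variables (R : realType) (X Y : normedModType R).
Implicit Types u v : alg_tensor X Y.

Definition projective_costs u : set R :=
  [set \sum_(p <- s) `|p.1| * `|p.2|
    | s in [set s : seq (X * Y) | u = tensor_sum s :> (_ -> _)]].

Definition projective_norm_fun u : R := inf (projective_costs u).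

Lemma projective_costs_lbound u : lbound (projective_costs u) 0.
Proof. by move=> _ [s _ <-]; apply: sumr_ge0 => p _; rewrite mulr_ge0. Qed.

Lemma projective_costs_has_inf u : has_inf (projective_costs u).
Proof.
split; last by exists 0; exact: projective_costs_lbound.
case: u => u uT; have /asboolP[s us] := uT.
by exists (\sum_(p <- s) `|p.1| * `|p.2|); exists s.
Qed.

Lemma projective_norm_subproofD u v :
  projective_norm_fun (u + v) <= projective_norm_fun u + projective_norm_fun v.
Proof.
apply/ler_addgt0Pr => e e0.
have e20 : 0 < e / 2 by rewrite divr_gt0.
have [_ [s us <-] /ltW Hs] := inf_adherent e20 (projective_costs_has_inf u).
have [_ [t vt <-] /ltW Ht] := inf_adherent e20 (projective_costs_has_inf v).
have H : projective_norm_fun (u + v)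
    <= \sum_(p <- s) `|p.1| * `|p.2| + \sum_(p <- t) `|p.1| * `|p.2|.
  apply: ge_inf; first by case: (projective_costs_has_inf (u + v)).
  by exists (s ++ t); rewrite ?big_cat//= tensor_sum_cat -us -vt.
apply: (le_trans H); rewrite [e in leRHS](splitr e) addrACA.
exact: lerD.
Qed.

Lemma projective_norm_leZ a u :
  projective_norm_fun (a *: u) <= `|a| * projective_norm_fun u.
Proof.
apply/ler_addgt0Pr => e e0.
have a0 : 0 < `|a| + 1 by rewrite ltr_wpDl.
have ea0 : 0 < e / (`|a| + 1) by rewrite divr_gt0.
have [_ [s us <-] /ltW Hs] := inf_adherent ea0 (projective_costs_has_inf u).
have H : projective_norm_fun (a *: u) <= `|a| * \sum_(p <- s) `|p.1| * `|p.2|.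
  apply: ge_inf; first by case: (projective_costs_has_inf (a *: u)).
  exists [seq (a *: p.1, p.2) | p <- s]; first by rewrite /= -tensor_sumZ -us.
  rewrite big_map mulr_sumr; apply: eq_bigr => p _.
  by rewrite normrZ mulrA.
apply: (le_trans H); apply: (le_trans (ler_wpM2l _ Hs)) => //.
rewrite mulrDr lerD2l mulrCA ger_pMr// ler_pdivrMr// mul1r lerDl//.
Qed.

Lemma projective_norm_subproofZ a u :
  projective_norm_fun (a *: u) = `|a| * projective_norm_fun u.
Proof.
apply/eqP; rewrite eq_le projective_norm_leZ /=.
have [->|a0] := eqVneq a 0.
  rewrite normr0 mul0r; apply: lb_le_inf (@projective_costs_lbound _).
  by case: (projective_costs_has_inf (0 *: u)).
have := projective_norm_leZ a^-1 (a *: u).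
by rewrite scalerA mulVf// scale1r normfV ler_pdivlMl// normr_gt0.
Qed.

Definition projective_norm : seminorm (alg_tensor X Y) :=
  Seminorm projective_norm_subproofD projective_norm_subproofZ.

End ProjectiveNorm.
Arguments projective_norm {R} X Y.

Section SeminormTheory.
Variables (R : realType) (V : lmodType R) (p : seminorm V).

Lemma seminorm0 : p 0 = 0.
Proof. by rewrite -(scale0r 0) seminormZ normr0 mul0r. Qed.

Lemma seminormN v : p (- v) = p v.
Proof. by rewrite -scaleN1r seminormZ normrN1 mul1r. Qed.

Lemma seminorm_distC u v : p (u - v) = p (v - u).
Proof. by rewrite -seminormN opprB. Qed.

Lemma seminorm_ge0 v : 0 <= p v.
Proof.
have := seminormD p v (- v).
by rewrite subrr seminorm0 seminormN -mulr2n pmulrn_lge0.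
Qed.

Lemma seminorm_triangle v u w : p (u - w) <= p (u - v) + p (v - w).
Proof. by have := seminormD p (u - v) (v - w); rewrite addrA subrK. Qed.

Lemma seminorm_dist u v : `|p u - p v| <= p (u - v).
Proof.
rewrite ler_norml lerNl opprB !lerBlDr; apply/andP; split.
  by have := seminormD p (v - u) u; rewrite subrK seminorm_distC.
by have := seminormD p (u - v) v; rewrite subrK.
Qed.

End SeminormTheory.

(* The completion of a seminormed space: Cauchy sequences modulo null
   sequences.  The construction identifies points at distance 0, which changes
   nothing when the seminorm is a norm, as projective_norm is. *)
Section CauchySequences.
Variables (R : realType) (V : lmodType R) (p : seminorm V).

Definition is_cauchy_seq : {pred nat -> V} := fun u =>
  `[< forall e : R, 0 < e -> exists N : nat, forall m n : nat,
        (N <= m)%N -> (N <= n)%N -> p (u m - u n) < e >].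

Lemma is_cauchy_seq_submod_closed : submod_closed is_cauchy_seq.
Proof.
split=> [|a u v /asboolP uC /asboolP vC]; apply/asboolP => e e0.
  by exists 0%N => m n _ _; rewrite subrr seminorm0.
have a0 : 0 < `|a| + 1 by rewrite ltr_wpDl.
have e20 : 0 < e / 2 by rewrite divr_gt0.
have [N NP] := uC (e / 2 / (`|a| + 1)) (divr_gt0 e20 a0).
have [M MP] := vC _ e20.
exists (maxn N M) => m n; rewrite !geq_max => /andP[Nm Mm] /andP[Nn Mn].
have -> : (a *: u + v) m - (a *: u + v) n = a *: (u m - u n) + (v m - v n).
  by rewrite scalerBr addrACA -opprD.
rewrite [e]splitr (le_lt_trans (seminormD _ _ _))// seminormZ ler_ltD//.
  have /ltW H := NP _ _ Nm Nn.
  rewrite (le_trans (ler_wpM2l _ H))// mulrCA ger_pMr// ler_pdivrMr// mul1r.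
  by rewrite lerDl.
exact: MP.
Qed.

HB.instance Definition _ :=
  GRing.isSubmodClosed.Build R (nat -> V) is_cauchy_seq
    is_cauchy_seq_submod_closed.

Record cauchy_seq := CauchySeq {
  seq_of_cauchy_seq :> nat -> V;
  _ : seq_of_cauchy_seq \in is_cauchy_seq }.

HB.instance Definition _ := [isSub for seq_of_cauchy_seq].
HB.instance Definition _ := [Choice of cauchy_seq by <:].
HB.instance Definition _ := [SubChoice_isSubLmodule of cauchy_seq by <:].

Implicit Types u v : cauchy_seq.

Lemma cauchy_seqP u (e : R) : 0 < e -> exists N : nat, forall m n : nat,
  (N <= m)%N -> (N <= n)%N -> p (u m - u n) < e.
Proof. by case: u => u /= uC; have /asboolP := uC; exact. Qed.

Lemma cauchy_seqB u v n : (u - v) n = u n - v n.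
Proof. by []. Qed.

Lemma cauchy_seqD u v n : (u + v) n = u n + v n.
Proof. by []. Qed.

Lemma cauchy_seqZ a u n : (a *: u) n = a *: u n.
Proof. by []. Qed.

Lemma cauchy_seq_seminorm_cvg u : cvgn (fun n => p (u n)).
Proof.
apply: R_complete; apply: cauchy_exP => e e0.
have [N NP] := cauchy_seqP u e0; exists (p (u N)).
exists N => // n /= Nn; rewrite -ball_normE /=.
exact: le_lt_trans (seminorm_dist _ _ _) (NP _ _ _ _).
Qed.

Definition is_null_seq : {pred cauchy_seq} := fun u =>
  `[< p (u n) @[n --> \oo] --> (0 : R) >].

Lemma is_null_seq_submod_closed : submod_closed is_null_seq.
Proof.
split=> [|a u v /asboolP u0 /asboolP v0]; apply/asboolP.
  under eq_fun do rewrite seminorm0; exact: cvg_cst.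
have H : (fun n => `|a| * p (u n) + p (v n)) @ \oo --> (0 : R).
  by rewrite -[0 in X in _ --> X]addr0 -{1}(mulr0 `|a|); apply: cvgD => //;
     apply: cvgMl_tmp.
apply: (squeeze_cvgr _ (cvg_cst 0) H); apply: nearW => n.
rewrite seminorm_ge0 /= -seminormZ; exact: seminormD.
Qed.

HB.instance Definition _ :=
  GRing.isSubmodClosed.Build R cauchy_seq is_null_seq
    is_null_seq_submod_closed.

End CauchySequences.

Section Completion.
Variables (R : realType) (V : lmodType R) (p : seminorm V).
Local Open Scope quotient_scope.
Implicit Types u v : cauchy_seq p.

Definition completion : Type := Quotient.quot (@is_null_seq R V p).

HB.instance Definition _ := GRing.Zmodule.on completion.

Implicit Types q r : completion.

Definition limit_class u : completion :=
  \pi_(Quotient.quot (@is_null_seq R V p)) u.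

Definition representative q : cauchy_seq p := repr q.

Lemma representativeK q : limit_class (representative q) = q.
Proof. exact: reprK. Qed.

Lemma limit_class_eqP u v :
  limit_class u = limit_class v <-> p (u n - v n) @[n --> \oo] --> (0 : R).
Proof.
split=> [uv|uv0].
  suff : u - v \in @is_null_seq R V p by move=> /asboolP.
  by rewrite Quotient.idealrBE; apply/eqP.
by apply/eqP; rewrite -[_ == _]Quotient.idealrBE; apply/asboolP.
Qed.

Lemma limit_classD u v :
  limit_class (u + v) = limit_class u + limit_class v.
Proof. exact: Quotient.pi_add. Qed.

Definition completion_scale (a : R) q : completion :=
  limit_class (a *: representative q).

Lemma limit_classZ_subproof a u :
  limit_class (a *: u) = completion_scale a (limit_class u).
Proof.
apply/limit_class_eqP.
have /limit_class_eqP H := esym (representativeK (limit_class u)).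
under eq_fun do rewrite -scalerBr seminormZ.
by rewrite -(mulr0 `|a|); apply: cvgMl_tmp.
Qed.

Lemma completion_scaleA a b q :
  completion_scale a (completion_scale b q) = completion_scale (a * b) q.
Proof.
by rewrite -(representativeK q) -!limit_classZ_subproof scalerA.
Qed.

Lemma completion_scale1 : left_id 1 completion_scale.
Proof.
by move=> q; rewrite -(representativeK q) -!limit_classZ_subproof scale1r.
Qed.

Lemma completion_scaleDr : right_distributive completion_scale +%R.
Proof.
move=> a q r; rewrite -(representativeK q) -(representativeK r).
by rewrite -limit_classD -!limit_classZ_subproof scalerDr limit_classD.
Qed.

Lemma completion_scaleDl q :
  {morph completion_scale^~ q : a b / a + b >-> a + b}.
Proof.
move=> a b; rewrite -(representativeK q).
by rewrite -!limit_classZ_subproof scalerDl limit_classD.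
Qed.

HB.instance Definition _ := GRing.Zmodule_isLmodule.Build R completion
  completion_scaleA completion_scale1 completion_scaleDr completion_scaleDl.

Lemma limit_classZ a u : limit_class (a *: u) = a *: limit_class u.
Proof. exact: limit_classZ_subproof. Qed.

Definition completion_norm q : R :=
  limn (fun n => p (representative q n)).

Lemma completion_norm_cvg_subproof u :
  p (u n) @[n --> \oo] --> completion_norm (limit_class u).
Proof.
have /limit_class_eqP H := representativeK (limit_class u).
have /= K := @cauchy_seq_seminorm_cvg _ _ _ (representative (limit_class u)).
have D : p (u n) - p (representative (limit_class u) n) @[n --> \oo]
    --> (0 : R).
  apply/cvgrPdist_le => e e0; move/cvgrPdist_le: H => /(_ e e0).
  apply: filterS => n; rewrite !sub0r !normrN => He.
  rewrite distrC (le_trans (seminorm_dist _ _ _))//.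
  exact: le_trans (ler_norm _) He.
have E : (fun n => p (u n)) = (fun n => p (representative (limit_class u) n) +
    (p (u n) - p (representative (limit_class u) n))).
  by apply/funext => n; rewrite addrC subrK.
by rewrite -[completion_norm _]addr0 E; exact: cvgD K D.
Qed.

Lemma completion_normD q r :
  completion_norm (q + r) <= completion_norm q + completion_norm r.
Proof.
rewrite -(representativeK q) -(representativeK r) -limit_classD.
set u := representative q; set v := representative r.
have uv : p ((u + v) n) @[n --> \oo] --> completion_norm (limit_class (u + v)).
  exact: completion_norm_cvg_subproof.
have uDv : p (u n) + p (v n) @[n --> \oo]
    --> completion_norm (limit_class u) + completion_norm (limit_class v).
  by apply: cvgD; exact: completion_norm_cvg_subproof.
apply: (ler_cvg_to uv uDv); apply: nearW => n; exact: seminormD.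
Qed.

Lemma completion_normZ (a : R) q :
  completion_norm (a *: q) = `|a| * completion_norm q.
Proof.
rewrite -(representativeK q) -limit_classZ.
have H := @completion_norm_cvg_subproof (a *: representative q).
apply: cvg_unique H _ => //.
rewrite [X in X @ _](_ : _ = fun n => `|a| * p (representative q n)).
  by apply: cvgMl_tmp; exact: completion_norm_cvg_subproof.
by apply/funext => n; rewrite -seminormZ.
Qed.

Lemma completion_norm_eq0 q : completion_norm q = 0 -> q = 0.
Proof.
rewrite -(representativeK q) => q0.
have H := @completion_norm_cvg_subproof (representative q).
rewrite q0 in H.
have -> : 0 = limit_class 0.
  by apply: (addrI (limit_class 0)); rewrite -limit_classD !addr0.
apply/limit_class_eqP.
by under eq_fun do rewrite subr0.
Qed.

HB.instance Definition _ := Lmodule_isNormed.Build R completion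
  completion_normD completion_normZ completion_norm_eq0.

Lemma limit_class_norm_cvg u :
  p (u n) @[n --> \oo] --> `|limit_class u|.
Proof. exact: completion_norm_cvg_subproof. Qed.

Lemma cst_is_cauchy_seq (x : V) : (fun=> x) \in @is_cauchy_seq R V p.
Proof.
by apply/asboolP => e e0; exists 0%N => m n _ _; rewrite subrr seminorm0.
Qed.

Definition to_completion (x : V) : completion :=
  limit_class (CauchySeq (cst_is_cauchy_seq x)).

Lemma to_completion_is_linear : linear to_completion.
Proof.
move=> a x y; rewrite /to_completion -limit_classZ -limit_classD.
by congr limit_class; apply/val_inj.
Qed.

HB.instance Definition _ :=
  GRing.isLinear.Build R V completion *:%R to_completion
    to_completion_is_linear.

Lemma norm_to_completion x : `|to_completion x| = p x.
Proof.
have H := @limit_class_norm_cvg (CauchySeq (cst_is_cauchy_seq x)).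
exact: (cvg_unique _ H (cvg_cst (p x))).
Qed.

Lemma to_completion_cvg u : to_completion (u n) @[n --> \oo] --> limit_class u.
Proof.
apply/cvgrPdist_le => e e0.
have [N NP] := cauchy_seqP u e0.
exists N => // m /= Nm.
have H : p (u n - u m) @[n --> \oo]
    --> `|limit_class u - to_completion (u m)|.
  rewrite -[- to_completion _]scaleN1r -limit_classZ scaleN1r -limit_classD.
  exact: limit_class_norm_cvg.
apply: (ler_cvg_to H (cvg_cst e)).
by exists N => // n /= Nn; apply/ltW/NP.
Qed.

Lemma to_completion_dense q (e : R) : 0 < e ->
  exists x : V, `|q - to_completion x| < e.
Proof.
move=> e0; have := @to_completion_cvg (representative q).
rewrite representativeK => /cvgrPdist_lt /(_ _ e0) [N _ /(_ N (leqnn N)) H].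
by exists (representative q N).
Qed.

Lemma completion_complete (F : set_system completion) :
  ProperFilter F -> cauchy F -> cvg F.
Proof.
move=> FF Fc.
have h0 n : 0 < n.+1%:R^-1 :> R by rewrite invr_gt0.
have /choice[a aP] n : exists q, F (ball q (n.+1%:R^-1 : R)).
  by by have /cauchyP /(_ _ (h0 n)) [q qP] := Fc; exists q.
have /choice[x xP] n := to_completion_dense (a n) (h0 n).
have ax m n : `|a m - a n| < m.+1%:R^-1 + n.+1%:R^-1.
  have [y [/=]] := filter_ex (filterI (aP m) (aP n)).
  rewrite -!ball_normE /= => ym yn.
  rewrite (le_lt_trans (ler_distD y _ _))// ltrD// distrC//.
have xx m n : p (x m - x n) < (m.+1%:R^-1 + n.+1%:R^-1) *+ 2.
  rewrite -norm_to_completion linearB /=.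
  have := ler_distD (a m) (to_completion (x m)) (to_completion (x n)).
  have := ler_distD (a n) (a m) (to_completion (x n)).
  have := ax m n; have := xP n; have := xP m.
  rewrite [X in X < _ -> _]distrC mulr2n.
  move: (m.+1%:R^-1) (n.+1%:R^-1) => c d *; lra.
have xC : x \in @is_cauchy_seq R V p.
  apply/asboolP => e e0; have e40 : 0 < e / 4 by rewrite divr_gt0.
  have [N _ NP] := near_infty_natSinv_lt (PosNum e40).
  exists N => m n Nm Nn; apply: lt_le_trans (xx m n) _.
  have /= := NP m Nm; have /= := NP n Nn.
  move: (m.+1%:R^-1) (n.+1%:R^-1) => c d *; lra.
have L := @to_completion_cvg (CauchySeq xC).
apply/cvg_ex; exists (limit_class (CauchySeq xC)).
apply/cvgrPdist_lt => e e0; have e30 : 0 < e / 3 by rewrite divr_gt0.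
move/cvgrPdist_lt: L => /(_ _ e30) L.
have [n [/= Ln ne]] :=
  filter_ex (filterI L (near_infty_natSinv_lt (PosNum e30))).
apply: filterS (aP n) => y; rewrite -ball_normE /= => yn.
have := ler_distD (to_completion (x n)) (limit_class (CauchySeq xC)) y.
have := ler_distD (a n) (to_completion (x n)) y.
have := xP n; rewrite [X in X < _ -> _]distrC.
move: (n.+1%:R^-1) yn ne => c *; lra.
Qed.

HB.instance Definition _ :=
  Uniform_isComplete.Build completion completion_complete.

End Completion.

Definition projective_tensor (R : realType) (X Y : normedModType R) :
  completeNormedModType R := completion (projective_norm X Y).

(* Main.v *)
Require Import Defs.
From HB Require Import structures.
From mathcomp Require Import all_boot all_order all_algebra.
From mathcomp Require Import all_classical all_reals all_analysis.
From mathcomp Require Import ring lra.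

Set Implicit Arguments.
Unset Strict Implicit.
Unset Printing Implicit Defensive.

Import Order.TTheory GRing.Theory Num.Theory.
Import numFieldNormedType.Exports.

Local Open Scope classical_set_scope.
Local Open Scope ring_scope.

(** Elements of the unit sphere of the projective tensor product are, up to
    a small error, finite sums of tensors u (x) v whose cost, the sum of the
    `|u| * `|v|, is close to 1.  Almost squareness of X and of Y gives x and y
    of norm almost 1 that are almost orthogonal, in the sense of the sup norm,
    to all the normalized u and all the normalized v that occur in these sums:
    `|u +/- x| <= 1 + d and `|v +/- y| <= 1 + d.  The vector looked for is
    x (x) y, because of the identity

      u (x) v + x (x) y
        = ((u + x) (x) (v + y) + (u - x) (x) (v - y)) / 2

    and of the one obtained by changing y into - y: each of them bounds
    `|u (x) v +/- x (x) y| by (1 + d)^2 (lemma [projective_norm_shift]), and a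
    sum of tensors of cost c moved by c x (x) y has norm at most (1 + d)^2 c
    ([projective_norm_shift_sum]).  Since c is almost 1, the sphere elements
    satisfy `|z +/- x (x) y| <= 1 + e.  The matching lower bounds are automatic:
    2 z is the sum of z + w and z - w, hence both norms are close to 1 as soon
    as neither exceeds 1 by much ([almost_square_intro]).

    It remains to see that x (x) y has norm almost 1, that is, that the
    projective norm of x (x) y is `|x| * `|y| ([projective_norm_tensor]).  The
    lower bound comes from evaluating tensors at the bilinear form f (x) g,
    where f and g are functionals of norm at most 1 with f x = `|x| and
    g y = `|y|.  These come from the Hahn-Banach theorem, proved by finding a
    minimal sublinear functional below a given one: minimality makes it
    linear. *)

(** * Sublinear functionals and the Hahn-Banach theorem *)

Section Sublinear.
Variables (R : realType) (V : lmodType R).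
Implicit Types (p q : V -> R) (u v x : V).

(** Homogeneity is asked as an inequality only: applied to t and to t^-1 it
    yields the equality, and inequalities pass directly to infima. *)
Definition sublinear q :=
  (forall u v, q (u + v) <= q u + q v) /\
  (forall (t : R) v, 0 < t -> q (t *: v) <= t * q v).

Lemma sublinear_opp_ge q v : sublinear q -> - q (- v) <= q v.
Proof.
move=> [qD _]; have := qD 0 0; have := qD v (- v).
rewrite addr0 subrr; lra.
Qed.

Lemma sublinear_mul_le q (t : R) v :
  sublinear q -> 0 <= t -> t * q v <= q (t *: v).
Proof.
move=> qs; have [qD qZ] := qs; rewrite le_eqVlt => /orP[/eqP <-|t0].
  by rewrite mul0r scale0r; have := qD 0 0; rewrite addr0; lra.
have t'0 : 0 < t^-1 by rewrite invr_gt0.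
have := qZ _ (t *: v) t'0.
by rewrite scalerA mulVf ?gt_eqF// scale1r ler_pdivlMl.
Qed.

Lemma inf_le_add (A B : set R) (c : R) : A !=set0 -> B !=set0 ->
  (forall a b, A a -> B b -> c <= a + b) -> c <= inf A + inf B.
Proof.
move=> A0 B0 H; rewrite -lerBlDr; apply: lb_le_inf => // a Aa.
rewrite lerBlDr addrC -lerBlDr; apply: lb_le_inf => // b Bb.
by rewrite lerBlDr addrC H.
Qed.

(** Infima of sublinear functionals need not be sublinear; the hypotheses ask
    that each inequality to be proved for the infimum hold for a suitable
    member [F k] of the family.  This covers both decreasing chains and the
    functionals [descent q v] below. *)
Lemma sublinear_inf (I : Type) (D : set I) (F : I -> V -> R) (m : V -> R) :
  D !=set0 ->
  (forall i v, D i -> m v <= F i v) ->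
  (forall i j u v, D i -> D j ->
    exists2 k, D k & F k (u + v) <= F i u + F j v) ->
  (forall i (t : R) v, D i -> 0 < t ->
    exists2 k, D k & F k (t *: v) <= t * F i v) ->
  sublinear (fun v => inf [set F i v | i in D]).
Proof.
move=> [i0 Di0] Fm FD FZ.
have lb v i : D i -> inf [set F i v | i in D] <= F i v.
  move=> Di; apply: ge_inf; last by exists i.
  by exists (m v) => _ [j Dj <-]; exact: Fm.
have ne v : [set F i v | i in D] !=set0 by exists (F i0 v), i0.
split=> [u v|t v t0].
  apply: inf_le_add => // _ _ [i Di <-] [j Dj <-].
  by have [k Dk] := FD i j u v Di Dj; apply: le_trans; exact: lb.
rewrite -ler_pdivrMl//; apply: lb_le_inf => // _ [i Di <-].
rewrite ler_pdivrMl//.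
by have [k Dk] := FZ i t v Di t0; apply: le_trans; exact: lb.
Qed.

(** The functional x |-> inf_(t >= 0) (q (x + t v) - t q v), which lies below q
    and takes at - v a value at most - q v (choose t = 1). *)
Definition descent q v : V -> R :=
  fun x => inf [set q (x + t *: v) - t * q v | t in [set t : R | 0 <= t]].

Lemma descent_lb q v (t : R) x : sublinear q -> 0 <= t ->
  - q (- x) <= q (x + t *: v) - t * q v.
Proof.
move=> qs t0; have [qD _] := qs.
have := sublinear_mul_le v qs t0; have := qD (- x) (x + t *: v).
rewrite addKr; lra.
Qed.

Lemma descent_sublinear q v : sublinear q -> sublinear (descent q v).
Proof.
move=> qs; have [qD qZ] := qs.
apply: (@sublinear_inf _ _ (fun t x => q (x + t *: v) - t * q v)
  (fun x => - q (- x))).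
- by exists 0; rewrite /= lexx.
- by move=> t x /= t0; exact: descent_lb.
- move=> s t x y /= s0 t0; exists (s + t); first by rewrite /= addr_ge0.
  have := qD (x + s *: v) (y + t *: v).
  rewrite addrACA -scalerDl; lra.
- move=> s r x /= s0 r0; exists (r * s); first by rewrite /= mulr_ge0// ltW.
  have := qZ r (x + s *: v) r0.
  rewrite scalerDr scalerA; lra.
Qed.

Lemma descent_le q v (t : R) x : sublinear q -> 0 <= t ->
  descent q v x <= q (x + t *: v) - t * q v.
Proof.
move=> qs t0; apply: ge_inf; last by exists t.
by exists (- q (- x)) => _ [s /= s0 <-]; exact: descent_lb.
Qed.

(** Zorn's lemma applies to the sublinear functionals below p, because all of
    them stay above v |-> - p (- v): a chain thus has a pointwise infimum with
    finite values. *)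
Lemma minimal_sublinear p : sublinear p ->
  exists q, [/\ sublinear q, forall v, q v <= p v &
    forall q', sublinear q' -> (forall v, q' v <= q v) -> q' = q].
Proof.
move=> ps.
pose T := {q : V -> R | sublinear q /\ forall v, q v <= p v}.
pose t0 : T := exist _ p (conj ps (fun v => lexx (p v))).
pose le_rel := [rel s t : T | `[< forall v, sval t v <= sval s v >]].
have [||A Atot|[q [qs qp]] qmin] := @ZL_preorder T t0 le_rel.
- by move=> s; apply/asboolP.
- move=> s r t /asboolP sr /asboolP st; apply/asboolP => v.
  exact: le_trans (st v) (sr v).
- have [->|/set0P[a0 Aa0]] := eqVneq A set0; first by exists t0.
  pose g v := inf [set sval a v | a in A].
  have lbA (a : T) v : A a -> - p (- v) <= sval a v.
    case: a => a [as_ ap] /= _.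
    by rewrite (le_trans _ (sublinear_opp_ge v as_))// lerN2.
  have gle (a : T) v : A a -> g v <= sval a v.
    move=> Aa; apply: ge_inf; last by exists a.
    by exists (- p (- v)) => _ [b Ab <-]; exact: lbA.
  have gs : sublinear g.
    apply: (sublinear_inf (m := fun v => - p (- v))); first by exists a0.
    + by move=> a v; exact: lbA.
    + move=> a b u v Aa Ab; have [/asboolP ab|/asboolP ba] := Atot _ _ Aa Ab.
      * by exists b => //; case: (svalP b) => -[bD _] _;
          rewrite (le_trans (bD _ _))// lerD2r.
      * by exists a => //; case: (svalP a) => -[aD _] _;
          rewrite (le_trans (aD _ _))// lerD2l.
    + by move=> a t v Aa t_gt0; exists a => //; case: (svalP a) => -[_ aZ] _;
        exact: aZ.
  have gp v : g v <= p v.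
    by apply: le_trans (gle _ v Aa0) _; case: (svalP a0).
  by exists (exist _ g (conj gs gp)) => s As; apply/asboolP => v; exact: gle.
exists q; split=> // q' q's q'q; apply/funext => v; apply/eqP.
rewrite eq_le q'q /=.
pose s : T := exist _ q' (conj q's (fun v => le_trans (q'q v) (qp v))).
have /asboolP := qmin s (asboolT q'q); exact.
Qed.

(** A minimal q equals [descent q v] for every v, so that q u <= q (u + v) - q v:
    q is superadditive, hence additive, hence linear. *)
Theorem hahn_banach p : sublinear p ->
  exists f : {linear V -> R^o}, forall v, f v <= p v.
Proof.
move=> ps; have [q [qs qp qmin]] := minimal_sublinear ps.
have [qD qZ] := qs.
have qB u v : q u + q v <= q (u + v).
  have E : descent q v = q.
    apply: qmin; first exact: descent_sublinear.
    move=> x; have := descent_le v x qs (lexx 0).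
    by rewrite scale0r addr0 mul0r subr0.
  have := descent_le v u qs ler01.
  by rewrite E scale1r mul1r lerBrDr.
have qA u v : q (u + v) = q u + q v by apply/eqP; rewrite eq_le qD qB.
have q0 : q 0 = 0 by have := qA 0 0; rewrite addr0; lra.
have qN v : q (- v) = - q v by have := qA v (- v); rewrite subrr q0; lra.
have qP (t : R) v : 0 <= t -> q (t *: v) = t * q v.
  rewrite le_eqVlt => /orP[/eqP <-|t0]; first by rewrite mul0r scale0r.
  by apply/eqP; rewrite eq_le qZ//= sublinear_mul_le// ltW.
have ql : linear (q : V -> R^o).
  move=> a u v; rewrite qA; congr (_ + _).
  have [a0|a0] := leP 0 a; first exact: qP.
  have na0 : 0 <= - a by rewrite oppr_ge0 ltW.
  have := qP _ u na0; rewrite scaleNr qN mulNr => /oppr_inj -> //.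
pose f : {linear V -> R^o} :=
  HB.pack (q : V -> R^o) (GRing.isLinear.Build R V R^o *:%R _ ql).
by exists f.
Qed.

End Sublinear.

(** * Norming functionals *)

Section NormingFunctional.
Variables (R : realType) (X : normedModType R).

Lemma norm_sublinear : sublinear (fun v : X => `|v|).
Proof.
split=> [u v|t v t0]; first exact: ler_normD.
by rewrite normrZ gtr0_norm.
Qed.

(** Below the norm alone, a linear functional may well vanish at x.  Starting
    instead from the descent of the norm along x forces f (- x) <= - `|x|. *)
Lemma norming_functional (x : X) :
  exists f : {linear X -> R^o}, f x = `|x| /\ forall v, `|f v| <= `|v|.
Proof.
have [f fp] := hahn_banach (descent_sublinear x norm_sublinear).
have fle v : f v <= `|v|.
  apply: (le_trans (fp v)).
  have := descent_le x v norm_sublinear (lexx 0).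
  by rewrite scale0r addr0 mul0r subr0.
exists f; split; last first.
  by move=> v; rewrite ler_norml fle lerNl -raddfN /= -(normrN v) fle.
apply/eqP; rewrite eq_le fle -lerN2 -raddfN /=.
apply: (le_trans (fp _)).
have := descent_le x (- x) norm_sublinear ler01.
by rewrite scale1r addNr normr0 mul1r sub0r.
Qed.

End NormingFunctional.

(** * Elementary tensors *)

Section ProductForm.
Variables (R : realType) (X Y : lmodType R).
Variables (f : {linear X -> R^o}) (g : {linear Y -> R^o}).

Definition product_form (x : X) (y : Y) : R^o := f x * g y.

Lemma product_form_is_bilinear : bilinear_for *:%R *:%R product_form.
Proof.
split=> [y a u v|x a u v]; rewrite /product_form linearP /=.
  by rewrite mulrDl /GRing.scale /= mulrA.
by rewrite mulrDr /GRing.scale /= mulrCA.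
Qed.

HB.instance Definition _ := bilinear_isBilinear.Build R X Y R^o *:%R *:%R
  product_form product_form_is_bilinear.

End ProductForm.

Section Elementary.
Variables (R : realType) (X Y : lmodType R).

Lemma elementary_is_tensor (x : X) (y : Y) :
  elementary_tensor x y \in @is_tensor R X Y.
Proof.
by apply/asboolP; exists [:: (x, y)]; rewrite /tensor_sum big_seq1.
Qed.

Definition tensor (x : X) (y : Y) : alg_tensor X Y :=
  AlgTensor (elementary_is_tensor x y).

Lemma tensor_sumE (s : seq (X * Y)) (u : alg_tensor X Y) :
  u = tensor_sum s :> (_ -> _) -> u = \sum_(p <- s) tensor p.1 p.2.
Proof.
move=> us; apply/val_inj; rewrite raddf_sum /=; exact: us.
Qed.

Lemma tensorN (x : X) (y : Y) : tensor x (- y) = - tensor x y.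
Proof. by apply/val_inj/funext => B; rewrite /= /elementary_tensor linearNr. Qed.

Lemma tensorZZ (a b : R) (x : X) (y : Y) :
  tensor (a *: x) (b *: y) = (a * b) *: tensor x y.
Proof.
apply/val_inj/funext => B; rewrite /= /elementary_tensor /=.
by rewrite linearZl_LR linearZr_LR /= scalerA.
Qed.

(** Expanding the right-hand side, the mixed terms u (x) y and x (x) v cancel.
    Both summands on the right have small norm when x and y are almost
    orthogonal to u and v, whereas the triangle inequality on the left-hand
    side would only give `|u| * `|v| + `|x| * `|y|. *)
Lemma tensor_polarization (u x : X) (v y : Y) :
  tensor u v + tensor x y =
  2^-1 *: (tensor (u + x) (v + y) + tensor (u - x) (v - y)).
Proof.
apply/val_inj/funext => B; rewrite /= /elementary_tensor /=.
change (B u v + B x y = 2^-1 * (B (u + x) (v + y) + B (u - x) (v - y))).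
rewrite linearBl linearDl !linearDr !linearNr /=.
by field.
Qed.

End Elementary.

(** * The projective norm *)

Section ProjectiveNormTensor.
Variables (R : realType) (X Y : normedModType R).
Local Notation pnorm := (projective_norm X Y).

Definition tensor_cost (s : seq (X * Y)) : R := \sum_(p <- s) `|p.1| * `|p.2|.

Lemma projective_norm_le_cost (u : alg_tensor X Y) s :
  u = tensor_sum s :> (_ -> _) -> pnorm u <= tensor_cost s.
Proof.
move=> us; apply: ge_inf; last by exists s.
by exists 0; exact: projective_costs_lbound.
Qed.

(** For the lower bound, the product of norming functionals of x and y takes
    the value `|x| * `|y| at (x, y), and is at most the cost on any
    representation of x (x) y. *)
Lemma projective_norm_tensor (x : X) (y : Y) :
  pnorm (tensor x y) = `|x| * `|y|.
Proof.
apply/eqP; rewrite eq_le; apply/andP; split.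
  have := @projective_norm_le_cost (tensor x y) [:: (x, y)].
  by rewrite /tensor_cost big_seq1; apply; rewrite /tensor_sum big_seq1.
have [f [fx fle]] := norming_functional x.
have [g [gy gle]] := norming_functional y.
apply: lb_le_inf; first by case: (projective_costs_has_inf (tensor x y)).
move=> _ [s /= us <-].
have := congr1 (fun T => T (product_form f g : {bilinear X -> Y -> R^o})) us.
rewrite /tensor_sum fct_sumE /elementary_tensor /= /product_form fx gy => ->.
apply: (le_trans (ler_norm _)); apply: (le_trans (ler_norm_sum _ _ _)).
by apply: ler_sum => p _; rewrite normrM ler_pM.
Qed.

(** The hypotheses are the homogeneous form of `|u +/- x| <= 1 + e for unit
    vectors u, and similarly for v and y; in this form zero vectors are
    harmless and no representation has to be normalized.  They are unchanged
    when y is replaced with - y, so that the statement also covers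
    subtraction of x (x) y. *)
Lemma projective_norm_shift (e : R) (u x : X) (v y : Y) : 0 <= e ->
  `|u + `|u| *: x| <= (1 + e) * `|u| -> `|u - `|u| *: x| <= (1 + e) * `|u| ->
  `|v + `|v| *: y| <= (1 + e) * `|v| -> `|v - `|v| *: y| <= (1 + e) * `|v| ->
  pnorm (tensor u v + (`|u| * `|v|) *: tensor x y)
    <= (1 + e) ^+ 2 * (`|u| * `|v|).
Proof.
move=> e0 uDx uBx vDy vBy; rewrite -tensorZZ tensor_polarization seminormZ.
have -> : (1 + e) ^+ 2 * (`|u| * `|v|) =
    `|2^-1| * (((1 + e) * `|u|) * ((1 + e) * `|v|) +
               ((1 + e) * `|u|) * ((1 + e) * `|v|)).
  by rewrite ger0_norm ?invr_ge0//; field.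
rewrite ler_wpM2l// (le_trans (seminormD _ _ _))// !projective_norm_tensor.
by rewrite lerD// ler_pM.
Qed.

Lemma projective_norm_shift_sum (e : R) (s : seq (X * Y)) (x : X) (y : Y) :
  0 <= e ->
  (forall p, p \in s -> `|p.1 + `|p.1| *: x| <= (1 + e) * `|p.1| /\
                        `|p.1 - `|p.1| *: x| <= (1 + e) * `|p.1|) ->
  (forall p, p \in s -> `|p.2 + `|p.2| *: y| <= (1 + e) * `|p.2| /\
                        `|p.2 - `|p.2| *: y| <= (1 + e) * `|p.2|) ->
  pnorm (\sum_(p <- s) tensor p.1 p.2 + tensor_cost s *: tensor x y)
    <= (1 + e) ^+ 2 * tensor_cost s.
Proof.
move=> e0; rewrite /tensor_cost; elim: s => [|p s IHs] sx sy.
  by rewrite !big_nil scale0r addr0 seminorm0 mulr0.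
rewrite !big_cons scalerDl addrACA mulrDr (le_trans (seminormD _ _ _))// lerD//.
  have [] := sx p (mem_head _ _); have [] := sy p (mem_head _ _).
  by move=> *; exact: projective_norm_shift.
by apply: IHs => q qs; [apply: sx|apply: sy]; rewrite inE qs orbT.
Qed.

End ProjectiveNormTensor.

(** * Almost squareness without sequences *)

Section AlmostSquareEpsilon.
Variables (R : realType) (X : normedModType R).

(** The vector [v0] excludes the zero space, which is almost square but
    contains no x of norm almost 1. *)
Lemma almost_square_epsilon : almost_square X ->
  forall (s : seq X) (v0 : X) (e : R), v0 != 0 -> 0 < e ->
  exists x : X, [/\ `|x| <= 1, 1 - e <= `|x| &
    forall v, v \in s -> `|v + `|v| *: x| <= (1 + e) * `|v| /\
                         `|v - `|v| *: x| <= (1 + e) * `|v|].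
Proof.
move=> hX s v0 e v0n0 e0.
pose normalize v : X := `|v|^-1 *: v.
have norm_normalize v : v != 0 -> `|normalize v| = 1.
  by move=> v0'; rewrite normrZ normfV normr_id mulVf ?normr_eq0.
(* Heading the list with v0 makes it nonempty even if s is {0} or empty. *)
pose t := normalize v0 :: [seq normalize v | v <- s & v != 0].
have t1 : forall v, v \in t -> `|v| = 1.
  move=> v; rewrite inE => /orP[/eqP ->|/mapP[w]]; first exact: norm_normalize.
  by rewrite mem_filter => /andP[w0 _] ->; exact: norm_normalize.
have [|y [y1 yto1 ty]] := hX (size t) (tnth (in_tuple t)) (ltn0Sn _).
  by move=> i; apply: t1; exact: mem_tnth.
have : \forall n \near \oo, 1 - e <= `|y n| /\ forall i,
    `|tnth (in_tuple t) i + y n| <= 1 + e /\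
    `|tnth (in_tuple t) i - y n| <= 1 + e.
  have near_le (w : nat -> R) : w n @[n --> \oo] --> (1 : R) ->
      \forall n \near \oo, 1 - e <= w n <= 1 + e.
    move=> /cvgrPdist_le /(_ _ e0); apply: filterS => n.
    by rewrite ler_norml => /andP[? ?]; apply/andP; split; lra.
  apply: filterS2 (near_le _ yto1) (_ : \forall n \near \oo, forall i, _).
    by move=> n /andP[ny _] ni; split; [exact: ny|exact: ni].
  apply: filter_forall => i; have [yD yB] := ty i.
  by apply: filterS2 (near_le _ yD) (near_le _ yB) => n /andP[_ ?] /andP[_ ?].
case/filter_ex => n [yn tn]; exists (y n); split=> // v vs.
have [->|v_neq0] := eqVneq v 0.
  by rewrite normr0 scale0r addr0 subr0 normr0 mulr0.
have vt : normalize v \in t.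
  by rewrite inE; apply/orP; right; apply: map_f; rewrite mem_filter v_neq0.
have vE : v = `|v| *: normalize v.
  by rewrite scalerA divff ?scale1r// normr_eq0.
have [i iE] := tnthP (in_tuple t) _ vt.
have := tn i; rewrite -iE => -[uD uB].
rewrite {1 4}vE -scalerDr -scalerBr !normrZ !normr_id.
by rewrite ![_ * `|v|]mulrC !ler_wpM2l.
Qed.

(** Only upper bounds on `|x i +/- y| are needed: their sum is at least
    `|2 x i| = 2, so that each norm is at least 2 - (1 + e) = 1 - e. *)
Lemma almost_square_intro :
  (forall (k : nat) (x : 'I_k -> X) (e : R), (0 < k)%N ->
    (forall i, `|x i| = 1) -> 0 < e ->
    exists y : X, [/\ `|y| <= 1, 1 - e <= `|y| &
      forall i, `|x i + y| <= 1 + e /\ `|x i - y| <= 1 + e]) ->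
  almost_square X.
Proof.
move=> H k x k0 x1.
have /choice[y yP] n := H k x n.+1%:R^-1 k0 x1 (ltac:(by rewrite invr_gt0)).
have to1 (w : nat -> R) :
    (forall n, 1 - n.+1%:R^-1 <= w n <= 1 + n.+1%:R^-1) ->
    w n @[n --> \oo] --> (1 : R).
  move=> wP; apply/cvgrPdist_le => e e0.
  apply: filterS (near_infty_natSinv_lt (PosNum e0)) => n /= ne.
  move: (n.+1%:R^-1) (wP n) ne => r /andP[? ?] ?; rewrite ler_norml.
  by apply/andP; split; lra.
have sum2 (i : 'I_k) n : 2 <= `|x i + y n| + `|x i - y n|.
  have := ler_normD (x i + y n) (x i - y n).
  by rewrite addrACA subrr addr0 -mulr2n normrMn x1.
exists y; split=> [n||i]; first by case: (yP n).
  apply: to1 => n; have [y1 yn _] := yP n; rewrite yn /=.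
  by rewrite (le_trans y1)// lerDl invr_ge0.
by split; apply: to1 => n; have [_ _ /(_ i)] := yP n; have := sum2 i n;
  move: (n.+1%:R^-1) => r ? [? ?]; apply/andP; split; lra.
Qed.

End AlmostSquareEpsilon.

(** * Almost squareness of the projective tensor product *)

Section ProjectiveTensor.
Variables (R : realType) (X Y : normedModType R).
Local Notation iota := (@to_completion R _ (projective_norm X Y)).

Lemma projective_tensor_approx (z : projective_tensor X Y) (e : R) :
  `|z| = 1 -> 0 < e -> exists s : seq (X * Y),
    [/\ `|z - iota (\sum_(p <- s) tensor p.1 p.2)| <= e,
        1 - e <= tensor_cost s & tensor_cost s <= 1 + 2 * e].
Proof.
move=> z1 e0; have [u zu] := to_completion_dense z e0.
have [_ [s us <-] sC] := inf_adherent e0 (projective_costs_has_inf u).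
exists s; rewrite -(tensor_sumE us).
have uc : projective_norm X Y u <= tensor_cost s by exact: projective_norm_le_cost.
have cu : tensor_cost s < projective_norm X Y u + e by exact: sC.
have : `|(`|z| - projective_norm X Y u)| <= e.
  by rewrite -norm_to_completion (le_trans (ler_dist_dist _ _))// ltW.
by rewrite z1 ler_norml => /andP[? ?]; split; [exact: ltW|lra|lra].
Qed.

End ProjectiveTensor.

Theorem theorem2p1 (R : realType) (X Y : completeNormedModType R)
    (hX : almost_square X) (hY : almost_square Y) :
  almost_square (projective_tensor X Y).
Proof.
apply: almost_square_intro => k z e k0 z1 e0.
(* For d <= 1 / 14, (1 + d)^2 (1 + 2 d) <= 1 + 11 d; the approximation of z i
   and the deviation of its cost from 1 add d + 2 d, which makes 14 d. *)
pose d : R := Num.min e 1 / 14.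
have m0 : 0 < Num.min e 1 by rewrite lt_min e0 ltr01.
have me : Num.min e 1 <= e by rewrite ge_min lexx.
have m1 : Num.min e 1 <= 1 by rewrite ge_min lexx orbT.
have d0 : 0 < d by rewrite /d; lra.
have d1 : d <= 1 / 14 by rewrite /d; lra.
have de : 14 * d <= e by rewrite /d; lra.
have /choice[s sP] i := projective_tensor_approx (z1 i) d0.
pose S := flatten [seq s i | i <- enum 'I_k].
have sS i p : p \in s i -> p \in S.
  by move=> ps; apply/flattenP; exists (s i) => //; rewrite map_f// mem_enum.
(* The cost of the first representation is positive, so X and Y are nonzero. *)
have [p0 p0P] : exists p : X * Y, `|p.1| * `|p.2| != 0.
  apply: contrapT => /forallNP p0.
  have [_ + _] := sP (Ordinal k0); rewrite /tensor_cost big1; first lra.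
  by move=> p _; apply/eqP; move/negP: (p0 p); rewrite negbK.
have [x0 y0] : p0.1 != 0 /\ p0.2 != 0.
  by move: p0P; rewrite mulf_eq0 !normr_eq0 negb_or => /andP[].
have [x [x1 xd xP]] := almost_square_epsilon hX [seq p.1 | p <- S] x0 d0.
have [y [y1 yd yP]] := almost_square_epsilon hY [seq p.2 | p <- S] y0 d0.
have wN : `|to_completion (projective_norm X Y) (tensor x y)| = `|x| * `|y|.
  by rewrite norm_to_completion projective_norm_tensor.
(* Used for y' = y and y' = - y. *)
have bound i (y' : Y) : `|y'| <= 1 ->
    (forall p, p \in s i -> `|p.2 + `|p.2| *: y'| <= (1 + d) * `|p.2| /\
                            `|p.2 - `|p.2| *: y'| <= (1 + d) * `|p.2|) ->
    `|z i + to_completion (projective_norm X Y) (tensor x y')| <= 1 + e.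
  move=> y'1 y'P; have [zs cge cle] := sP i.
  have sx p : p \in s i -> `|p.1 + `|p.1| *: x| <= (1 + d) * `|p.1| /\
                           `|p.1 - `|p.1| *: x| <= (1 + d) * `|p.1|.
    by move=> /sS pS; apply: xP; exact: map_f.
  have := projective_norm_shift_sum (ltW d0) sx y'P.
  move: (\sum_(p <- s i) tensor _ _) (tensor_cost (s i)) zs cge cle.
  move=> u c zu cge cle uc.
  set J := to_completion _.
  (* The shift lemma moves u by c times the tensor; the remainder 1 - c is paid
     for separately. *)
  have -> : z i + J (tensor x y') =
      (z i - J u) + (J (u + c *: tensor x y') + (1 - c) *: J (tensor x y')).
    have -> : J (u + c *: tensor x y') = J u + c *: J (tensor x y').
      by rewrite /J linearD linearZ.
    by rewrite scalerBl scale1r -[J u + _ + _]addrA subrKC addrA subrK.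
  have w1 : `|J (tensor x y')| <= 1.
    by rewrite norm_to_completion projective_norm_tensor mulr_ile1.
  have c1 : `|1 - c| <= 2 * d by rewrite ler_norml; apply/andP; split; lra.
  have b1 : `|(1 - c) *: J (tensor x y')| <= 2 * d.
    by rewrite normrZ -[2 * d]mulr1 ler_pM.
  have b2 : `|J (u + c *: tensor x y')| <= (1 + d) ^+ 2 * c.
    by rewrite norm_to_completion.
  have b3 : (1 + d) ^+ 2 * c <= 1 + 11 * d by nra.
  have := ler_normD (z i - J u)
    (J (u + c *: tensor x y') + (1 - c) *: J (tensor x y')).
  have := ler_normD (J (u + c *: tensor x y')) ((1 - c) *: J (tensor x y')).
  lra.
exists (to_completion _ (tensor x y)); split.
- by rewrite wN mulr_ile1.
- by rewrite wN; nra.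
- move=> i; split.
    apply: bound => // p /sS pS; apply: yP; exact: map_f.
  rewrite -raddfN -tensorN; apply: bound; first by rewrite normrN.
  move=> p /sS pS; rewrite scalerN opprK.
  by have [] := yP p.2 (map_f _ pS).
Qed.
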